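(* There exist absolute constants $c_1,c_2,c_3>0$ with the following property. For every integer $k>0$ and every (randomized) memoryless routing algorithm $\mathcal{A}$, there exists a convex subdivision $G=(V,E)$ and vertices $s,t\in V$ such that: <ul> <li>$c_1k\le |V|\le c_2k$, and</li> <li>the expected number of steps taken by $\mathcal{A}$ when routing a packet from $s$ to $t$ in $G$ is at least $c_3k^2$.</li> </ul>
   Context: A geometric graph $G=(V,E)$ has vertex set $V\subset\mathbb{R}^2$ and straight-line edges. A convex subdivision is a plane geometric graph all of whose faces, except the outer face, are convex polygons, and whose outer face is the complement of a convex polygon. For a vertex $v$, $N(v)$ denotes the set of neighbours of $v$. A randomized memoryless routing algorithm is given by a function $f:\mathbb{R}^2\times\mathbb{R}^2\times(\mathbb{R}^2)^+\times\{0,1\}^\infty\to\mathbb{R}^2$ such that $f(v,t,N(v),B)\in N(v)$ and $f(t,t,N(t),B)=t$ for all inputs. To route a packet toward $t$ while it is at vertex $v$, the algorithm moves it to $f(v,t,N(v),B)$, where $B$ is a sequence of random bits chosen fresh and independently at each step. Thus the decision depends only on the coordinates of $v$, of $t$, and of the neighbours of $v$, together with fresh randomness. A deterministic memoryless routing algorithm is the special case where $f$ does not depend on $B$. The number of steps is the number of moves made until the packet first reaches $t$. Its expectation may be infinite. *)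

(* Defs.v *)
From HB Require Import structures.
From mathcomp Require Import all_boot all_order all_algebra finmap.
From mathcomp Require Import all_classical all_reals all_analysis.
Set Implicit Arguments. Unset Strict Implicit. Unset Printing Implicit Defensive.
Import Order.TTheory GRing.Theory Num.Theory.
Import numFieldNormedType.Exports.
Local Open Scope classical_set_scope.
Local Open Scope ring_scope.

Section Geometry.
Variable R : realType.

Local Notation pt := (R * R)%type.

Definition comb (l : R) (x y : pt) : pt :=
  ((1 - l) * x.1 + l * y.1, (1 - l) * x.2 + l * y.2).

Definition seg (x y : pt) : set pt := [set comb l x y | l in `[0, 1]%classic].
Definition oseg (x y : pt) : set pt := [set comb l x y | l in `]0, 1[%classic].

Definition convex_pt (A : set pt) : Prop :=
  forall x y l, A x -> A y -> 0 <= l <= 1 -> A (comb l x y).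

Definition bounded_pt (A : set pt) : Prop :=
  exists M : R, forall p, A p -> `|p.1| <= M /\ `|p.2| <= M.

Definition has_interior (A : set pt) : Prop :=
  exists (p : pt) (r : R), 0 < r /\
    forall q : pt, `|q.1 - p.1| < r -> `|q.2 - p.2| < r -> A q.

(* Geometric graph: finite vertex set V, edges E given as pairs (undirected:
   (a,b) and (b,a) denote the same edge), drawn as straight segments. *)
Definition geom_graph (V : {fset pt}) (E : {fset pt * pt}) : Prop :=
  forall e, e \in E -> [/\ e.1 \in V, e.2 \in V & e.1 != e.2].

Definition same_edge (e f : pt * pt) : Prop :=
  (e.1 = f.1 /\ e.2 = f.2) \/ (e.1 = f.2 /\ e.2 = f.1).

Definition plane_graph (V : {fset pt}) (E : {fset pt * pt}) : Prop :=
  [/\ geom_graph V E,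
      (forall v e, v \in V -> e \in E -> ~ oseg e.1 e.2 v) &
      (forall e f, e \in E -> f \in E -> ~ same_edge e f ->
         seg e.1 e.2 `&` seg f.1 f.2 `<=`
           [set e.1; e.2] `&` [set f.1; f.2])].

Definition drawing (V : {fset pt}) (E : {fset pt * pt}) : set pt :=
  [set p | p \in V] `|`
  \bigcup_(e in [set e | e \in E]) seg e.1 e.2.

Definition face (V : {fset pt}) (E : {fset pt * pt}) (F : set pt) : Prop :=
  exists x, (~` drawing V E) x /\ F = @connected_component (R * R)%type (~` drawing V E) x.

(* Convex subdivision: plane geometric graph whose bounded faces are convex
   (polygons) and whose outer (unbounded) face is the complement of a convex
   polygon (a convex set with nonempty interior). *)
Definition convex_subdivision (V : {fset pt}) (E : {fset pt * pt}) : Prop :=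
  [/\ plane_graph V E,
      (forall F, face V E F -> bounded_pt F -> convex_pt F) &
      (forall F, face V E F -> ~ bounded_pt F ->
         convex_pt (~` F) /\ has_interior (~` F))].

Definition adj (E : {fset pt * pt}) (v w : pt) : bool :=
  ((v, w) \in E) || ((w, v) \in E).

Definition nbrs (V : {fset pt}) (E : {fset pt * pt}) (v : pt) : {fset pt} :=
  [fset w in V | adj E v w]%fset.

(* Randomized memoryless routing algorithm: at the current vertex v, with
   target t and neighbour set N, the next vertex is drawn (with fresh
   randomness) from a probability distribution on N depending only on
   (v, t, N).  [p v t N w] is the probability of moving to w. *)
Record routing_alg := RoutingAlg {
  rprob : pt -> pt -> {fset pt} -> pt -> R;
  rprob_ge0 : forall v t N w, 0 <= rprob v t N w;
  rprob_supp : forall v t N w, w \notin N -> rprob v t N w = 0;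
  rprob_sum1 : forall v t N, N != fset0%fset -> \sum_(w <- N) rprob v t N w = 1
}.

Fixpoint survive (A : routing_alg) (V : {fset pt}) (E : {fset pt * pt})
    (t : pt) (n : nat) (v : pt) : R :=
  match n with
  | 0 => if v == t then 0 else 1
  | n'.+1 => if v == t then 0 else
      \sum_(w <- nbrs V E v) rprob A v t (nbrs V E v) w * survive A V E t n' w
  end.

(* expected number of steps until first reaching t, E[T] = sum_n P(T > n),
   in the extended reals (possibly +oo) *)
Definition expected_steps (A : routing_alg) (V : {fset pt})
    (E : {fset pt * pt}) (s t : pt) : \bar R :=
  (\sum_(0 <= n <oo) (survive A V E t n s)%:E)%E.

End Geometry.

(* Main.v *)
(* Let t = 0 be the target. Along a segment, Ramsey's theorem provides
   arbitrarily long sequences of points such that at each of them, seeing its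
   predecessor and its successor, the algorithm moves in one and the same
   direction with probability at least 1/2: the segment "drifts" towards one of
   its ends. If t can only be reached against the drift of paths of k vertices,
   the level along these paths behaves at best like a symmetric random walk
   reflected at k, and reaching t takes about k^2 steps.
   Around t take a triangle XYZ, and extend each of its sides beyond both ends:
   this gives two exits at each corner, turning counterclockwise and clockwise
   around t. If all three exits of one orientation drift outwards, the pinwheel
   made of t, XYZ, these exits and the triangle of their outer ends is a bad
   graph. Otherwise either two exits on one line both drift inwards, or a
   counterclockwise exit at a corner and the clockwise one at the next corner
   both drift outwards; in each case a convex polygon with vertex t, having the
   two segments on its boundary, is a bad graph. *)
Require Import Defs.
From HB Require Import structures.
From mathcomp Require Import all_boot all_order all_algebra finmap.
From mathcomp Require Import all_classical all_reals all_analysis.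
From mathcomp Require Import zify ring lra.
Set Implicit Arguments. Unset Strict Implicit. Unset Printing Implicit Defensive.
Import Order.TTheory GRing.Theory Num.Theory.
Import numFieldNormedType.Exports.
Local Open Scope classical_set_scope.
Local Open Scope ring_scope.

(** * Ramsey selection by limits along a free ultrafilter *)

Lemma ultrafilter_limit_bool (F : set_system nat) (p : nat -> bool) :
  UltraFilter F -> exists b, F [set n | p n = b].
Proof.
move=> FU; case: (in_ultra_setVsetC [set n | p n] FU) => H; first by exists true.
by exists false; apply: filterS H => n /negP /negbTE.
Qed.

(* Iterated limits along a free ultrafilter give a colour [b]; a pair is kept
   as long as its own limit colour is [b], and can then be prolonged. *)
Lemma monochromatic_consecutive_triples (c : nat -> nat -> nat -> bool) :
  exists (y : nat -> nat) (b : bool),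
    (forall n, (y n < y n.+1)%N) /\
    (forall n, c (y n) (y n.+1) (y n.+2) = b).
Proof.
have [F [FU ooF]] := ultraFilterLemma (F := \oo) _.
have Fgt n : F [set l | (n < l)%N] by apply: ooF; exists n.+1.
have /choice [c2 c2P] : forall ij : nat * nat, exists b,
    F [set l | c ij.1 ij.2 l = b].
  by move=> ij; exact: ultrafilter_limit_bool.
have /choice [c1 c1P] : forall i, exists b, F [set j | c2 (i, j) = b].
  by move=> i; exact: ultrafilter_limit_bool.
have [b c0P] := ultrafilter_limit_bool c1 FU.
pose ok (ij : nat * nat) := c2 ij = b /\ c1 ij.2 = b.
have /choice [next nextP] : forall ij : nat * nat, exists l, ok ij ->
    [/\ (ij.2 < l)%N, c ij.1 ij.2 l = b & ok (ij.2, l)].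
  move=> ij; have [okij|] := pselect (ok ij); last by exists 0%N.
  have [h1 h2] := okij.
  have H1 := c2P ij; rewrite h1 in H1.
  have H2 := c1P ij.2; rewrite h2 in H2.
  have [l [[? ?] [? ?]]] := filter_ex
    (filterI (filterI H1 H2) (filterI c0P (Fgt ij.2))).
  by exists l => _; split.
have [i0 c1i0] := filter_ex c0P.
have H0 := c1P i0; rewrite c1i0 in H0.
have [j0 [[c2j0 c1j0] lt0]] := filter_ex (filterI (filterI H0 c0P) (Fgt i0)).
(* [s n] holds two consecutive terms of the sequence being built. *)
pose s n := iter n (fun ij => (ij.2, next ij)) (i0, j0).
have sok n : ok (s n) /\ ((s n).1 < (s n).2)%N.
  elim: n => [|n [okn _]]; first by split=> //; split.
  by have [? ? ?] := nextP _ okn; split.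
exists (fun n => (s n).1), b; split=> n; first exact: (sok n).2.
by have [_ ] := nextP _ (sok n).1.
Qed.

(** * Lower bounds on hitting times from a potential *)

Section Walk.
Variable R : realType.
Local Notation pt := (R * R)%type.
Implicit Types (A : routing_alg R) (V : {fset pt}) (E : {fset pt * pt}).

Lemma in_nbrs V E v w : (w \in nbrs V E v) = (w \in V) && adj E v w.
Proof. by rewrite !inE. Qed.

Lemma nbrs_sub V E v w : w \in nbrs V E v -> w \in V.
Proof. by rewrite in_nbrs => /andP[]. Qed.

Lemma survive_ge0 A V E t n v : 0 <= survive A V E t n v.
Proof.
elim: n v => [|n IH] v /=; case: ifP => // _.
by apply: sumr_ge0 => w _; rewrite mulr_ge0 ?rprob_ge0.
Qed.

Lemma rprob_sum_le1 A v t (N : {fset pt}) : \sum_(w <- N) rprob A v t N w <= 1.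
Proof.
have [->|N0] := eqVneq N fset0%fset; first by rewrite big_seq_fset0.
by rewrite rprob_sum1.
Qed.

Lemma survive_nonincreasing A V E t n v :
  survive A V E t n.+1 v <= survive A V E t n v.
Proof.
elim: n v => [|n IH] v.
  rewrite /=; case: ifP => // _; apply: le_trans (rprob_sum_le1 A v t (nbrs V E v)).
  apply: ler_sum => w _; case: ifP => _; last by rewrite mulr1.
  by rewrite mulr0 rprob_ge0.
rewrite [leLHS]/= [leRHS]/=; case: ifP => // _.
by apply: ler_sum => w _; rewrite ler_wpM2l ?rprob_ge0 ?IH.
Qed.

(* The last term accounts for the walks that have not reached [t] after [n]
   steps. *)
Lemma potential_le_survive A V E t (g : pt -> R) (M : R) (n : nat) v :
    g t <= 0 -> (forall v, v \in V -> g v <= M) ->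
    (forall v, v \in V -> v != t -> g v <=
       1 + \sum_(w <- nbrs V E v) rprob A v t (nbrs V E v) w * g w) ->
    v \in V ->
  g v <= \sum_(i < n) survive A V E t i v + M * survive A V E t n v.
Proof.
move=> gt0 gM drift; elim: n v => [|n IH] v vV.
  rewrite big_ord0 add0r /=; case: eqP => [->|_]; first by rewrite mulr0.
  by rewrite mulr1 gM.
have [->|vt] := eqVneq v t.
  rewrite (le_trans gt0)// addr_ge0 ?sumr_ge0 //.
    by move=> i _; exact: survive_ge0.
  by rewrite /= eqxx mulr0.
apply: le_trans (drift v vV vt) _.
rewrite big_ord_recl /= (negbTE vt) -addrA lerD2l.
have -> : \sum_(i < n) \sum_(w <- nbrs V E v)
      rprob A v t (nbrs V E v) w * survive A V E t i w =
    \sum_(w <- nbrs V E v) rprob A v t (nbrs V E v) w *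
      \sum_(i < n) survive A V E t i w.
  rewrite exchange_big /=; apply: eq_bigr => w _.
  by rewrite mulr_sumr.
rewrite mulr_sumr -big_split /= big_seq [leRHS]big_seq.
apply: ler_sum => w wN; rewrite mulrCA -mulrDr ler_wpM2l ?rprob_ge0//.
exact/IH/(nbrs_sub wN).
Qed.

(* Since [survive] is nonincreasing, the last term above is at most the sum for
   [n = M], whence the factor 2. *)
Lemma potential_le_expected_steps A V E s t (g : pt -> R) (M : nat) :
    g t <= 0 -> (forall v, v \in V -> g v <= M%:R) ->
    (forall v, v \in V -> v != t -> g v <=
       1 + \sum_(w <- nbrs V E v) rprob A v t (nbrs V E v) w * g w) ->
    s \in V ->
  ((g s / 2)%:E <= expected_steps A V E s t)%E.
Proof.
move=> gt0 gM drift sV.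
have H := potential_le_survive M gt0 gM drift sV.
have le_sum : M%:R * survive A V E t M s <= \sum_(i < M) survive A V E t i s.
  rewrite mulr_natl -[X in _ *+ X]card_ord -sumr_const; apply: ler_sum => i _.
  have /nonincreasing_seqP mono : forall m,
      survive A V E t m s >= survive A V E t m.+1 s.
    by move=> m; exact: survive_nonincreasing.
  exact/mono/ltnW.
apply: (@le_trans _ _ (\sum_(0 <= i < M) (survive A V E t i s)%:E)%E).
  by rewrite sumEFin lee_fin big_mkord; lra.
by apply: nneseries_lim_ge => n _ _; rewrite lee_fin survive_ge0.
Qed.

End Walk.

(* Positive to the left of the line from [l.1] to [l.2]. *)
Definition side (R : pzRingType) (l : (R * R) * (R * R)) (p : R * R) : R :=
  (l.2.1 - l.1.1) * (p.2 - l.1.2) - (l.2.2 - l.1.2) * (p.1 - l.1.1).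

Lemma side_rev (R : comPzRingType) (l : (R * R) * (R * R)) p :
  side (l.2, l.1) p = - side l p.
Proof. by rewrite /side /=; ring. Qed.

(** * Half-planes, polygons and the faces of a drawing *)

Section Faces.
Variable R : realType.
Local Notation pt := (R * R)%type.
Implicit Types (p q : pt) (l : pt * pt) (ls : seq (pt * pt)).

Lemma separated_open (T : topologicalType) (U W : set T) :
  open U -> open W -> U `&` W = set0 -> separated U W.
Proof.
move=> oU oW UW0.
have disj (A B : set T) : open B -> A `&` B = set0 -> closure A `&` B = set0.
  move=> oB AB0; rewrite -subset0 => p [clA Bp].
  have [q] := clA B (open_nbhs_nbhs (conj oB Bp)).
  by rewrite AB0.
by split; rewrite ?[U `&` _]setIC; apply: disj => //; rewrite setIC.
Qed.

(** A connected subset of a union of two separated sets lies in one of them, and the component of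
    [x] meets [U]. *)
Lemma connected_component_clopen (T : topologicalType) (U W : set T) (x : T) :
  open U -> open W -> U `&` W = set0 -> connected U -> U x ->
  connected_component (U `|` W) x = U.
Proof.
move=> oU oW UW0 cU Ux; apply/seteqP; split; last first.
  by apply: connected_component_max => //; exact: subsetUl.
have [//|CW] := connected_subset (separated_open oU oW UW0)
  (@connected_component_sub _ (U `|` W) x) (@component_connected _ _ x).
have /CW Wx : connected_component (U `|` W) x x.
  by apply: connected_component_refl; left.
by exfalso; have : (U `&` W) x by []; rewrite UW0.
Qed.

(** A convex set is a star of segments issued from any of its points. *)
Lemma convex_connected (A : set pt) : convex_pt A -> connected A.
Proof.
move=> cA; have [[a Aa]|A0] := pselect (A !=set0); last first.
  have -> : A = set0 by rewrite -subset0 => p Ap; apply: A0; exists p.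
  exact: connected0.
have -> : A = \bigcup_(q in A) seg a q.
  apply/seteqP; split=> [q Aq|_ [q Aq [x /= x01 <-]]].
    exists q => //; exists 1; first by rewrite /= in_itv /= ler01 lexx.
    by rewrite /comb subrr !mul0r !add0r !mul1r -surjective_pairing.
  by apply: cA => //; move: x01; rewrite in_itv.
apply: bigcup_connected.
  exists a => q Aq; exists 0; first by rewrite /= in_itv /= lexx ler01.
  by rewrite /comb subr0 !mul0r !addr0 !mul1r -surjective_pairing.
move=> q _; apply: connected_continuous_connected; first exact: segment_connected.
apply: continuous_subspaceT => x.
have c (u v : R) : continuous (fun x : R => (1 - x) * u + x * v).
  move=> z; apply: cvgD; apply: cvgM; try exact: cvg_cst; try exact: cvg_id.
  by apply: cvgB; [exact: cvg_cst|exact: cvg_id].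
exact: cvg_pair (c a.1 q.1 x) (c a.2 q.2 x).
Qed.

(** When [ls] lists the sides of a convex polygon counterclockwise, [inner] is its interior and
    [outer] the complement of the closed polygon. *)
Definition inner ls : set pt := [set p | all (fun l => 0 < side l p) ls].

Definition outer ls : set pt := [set p | has (fun l => side l p < 0) ls].

Lemma side_comb l x p q :
  side l (comb x p q) = (1 - x) * side l p + x * side l q.
Proof. by rewrite /side /comb /=; ring. Qed.

Lemma continuous_side l : continuous (side l).
Proof.
move=> p; apply: cvgB; apply: cvgM; try exact: cvg_cst;
  apply: cvgB; try exact: cvg_cst; [exact: cvg_snd|exact: cvg_fst].
Qed.

Lemma open_side_gt0 l : open [set p | 0 < side l p].
Proof.
apply: (@open_comp _ _ (side l) [set x | 0 < x]); last exact: open_gt.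
by move=> p _; exact: continuous_side.
Qed.

Lemma open_side_lt0 l : open [set p | side l p < 0].
Proof.
apply: (@open_comp _ _ (side l) [set x | x < 0]); last exact: open_lt.
by move=> p _; exact: continuous_side.
Qed.

Lemma outer_cons l ls : outer (l :: ls) = [set p | side l p < 0] `|` outer ls.
Proof. by apply/seteqP; split=> p /=; rewrite /outer /= => /orP. Qed.

Lemma open_inner ls : open (inner ls).
Proof.
elim: ls => [|l ls IH].
  by rewrite (_ : inner [::] = setT); [exact: openT|by apply/seteqP; split].
rewrite (_ : inner _ = [set p | 0 < side l p] `&` inner ls).
  by apply: openI => //; exact: open_side_gt0.
by apply/seteqP; split=> p /=; rewrite /inner /= => /andP.
Qed.

Lemma open_outer ls : open (outer ls).
Proof.
elim: ls => [|l ls IH].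
  by rewrite (_ : outer [::] = set0); [exact: open0|by apply/seteqP; split].
by rewrite outer_cons; apply: openU => //; exact: open_side_lt0.
Qed.

Lemma convex_inner ls : convex_pt (inner ls).
Proof.
move=> p q x /allP pP /allP qP /andP[x0 x1]; apply/allP => l lls.
by rewrite side_comb; have := pP _ lls; have := qP _ lls; nra.
Qed.

Lemma convex_setC_outer ls : convex_pt (~` outer ls).
Proof.
move=> p q x /negP /hasPn pP /negP /hasPn qP /andP[x0 x1].
apply/negP/hasPn => l lls; rewrite side_comb -leNgt.
by have := pP _ lls; have := qP _ lls; rewrite -!leNgt; nra.
Qed.

Lemma connected_side_lt0 l : connected [set p | side l p < 0].
Proof.
apply: convex_connected => p q x /= pP qP /andP[x0 x1].
by rewrite side_comb; nra.
Qed.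

Lemma connected_outer1 l : connected (outer [:: l]).
Proof.
rewrite outer_cons (_ : outer [::] = set0) ?setU0; last by apply/seteqP; split.
exact: connected_side_lt0.
Qed.

Lemma connected_outer_cons p l l' ls :
  side l p < 0 -> side l' p < 0 ->
  connected (outer (l' :: ls)) -> connected (outer (l :: l' :: ls)).
Proof.
move=> lp l'p c; rewrite outer_cons; apply: connectedU => //.
  by exists p; split=> //; rewrite outer_cons; left.
exact: connected_side_lt0.
Qed.

Lemma open_has_interior (A : set pt) p : open A -> A p -> has_interior A.
Proof.
move=> oA Ap; have /nbhs_ballP[r /= r0 rA] : nbhs p A by exact: open_nbhs_nbhs.
exists p, r; split=> // q q1 q2; apply: rA.
by split; rewrite /ball /= distrC.
Qed.

(* The reflection of [c] through a corner of the polygon lies beyond both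
   sides that meet there. *)
Lemma connected_outer ls c : sorted (fun l l' => l.2 == l'.1) ls ->
  inner ls c -> connected (outer ls).
Proof.
case: ls => [|l ls].
  by rewrite (_ : outer [::] = set0) => *; [exact: connected0|
    by apply/seteqP; split].
elim: ls l => [|l' ls IH] l /=; first by move=> *; exact: connected_outer1.
move=> /andP[/eqP ll' pls] /and3P[lc l'c lsc].
apply: (@connected_outer_cons (comb 2 c l.2)).
- by rewrite side_comb; rewrite /side in lc *; nra.
- by rewrite side_comb ll'; rewrite /side in l'c *; nra.
- by apply: IH => //; rewrite /inner /= l'c.
Qed.

Variables (V : {fset pt}) (E : {fset pt * pt}).
Variables (hull : seq (pt * pt)) (cells : seq (seq (pt * pt))) (B : R).
Hypothesis drawingC : forall p,
  (~` drawing V E) p <-> outer hull p \/ exists2 c, c \in cells & inner c p.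
Hypothesis cells_disjoint : forall c c' p, c \in cells -> c' \in cells ->
  inner c p -> inner c' p -> c = c'.
Hypothesis cells_hull : forall c p, c \in cells -> inner c p -> ~ outer hull p.
Hypothesis connected_hull : connected (outer hull).
Hypothesis bounded_hull : forall p, ~ outer hull p -> `|p.1| <= B /\ `|p.2| <= B.

(** The complement of the drawing is a disjoint union of connected open sets, the cells and the
    outside of the hull, so these are its components. *)
Lemma face_hull_or_cell F :
  face V E F -> F = outer hull \/ exists2 c, c \in cells & F = inner c.
Proof.
case=> x [/[dup] Dx /drawingC + ->].
have E0 : ~` drawing V E = outer hull `|` \bigcup_(c in [set` cells]) inner c.
  apply/seteqP; split=> p.
    by move=> /drawingC [|[c]]; [left|right; exists c].
  by move=> [|[c]] *; apply/drawingC; [left|right; exists c].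
case=> [Hx|[c cC cx]]; [left|right; exists c => //].
  rewrite E0; apply: connected_component_clopen => //.
  - exact: open_outer.
  - by apply: bigcup_open => c _; exact: open_inner.
  - by rewrite -subset0 => p [Hp [c /= cC /cells_hull]]; apply.
rewrite (_ : ~` drawing V E = inner c `|` (outer hull `|`
    \bigcup_(c' in [set c' | c' \in cells /\ c' <> c]) inner c')).
  apply: connected_component_clopen => //; first exact: open_inner.
  - apply: openU; first exact: open_outer.
    by apply: bigcup_open => c' _; exact: open_inner.
  - rewrite -subset0 => p [cp [|[c' [c'C c'c] c'p]]]; first exact: cells_hull cp.
    by apply: c'c; exact: (cells_disjoint c'C cC c'p).
  - exact/convex_connected/convex_inner.
rewrite E0; apply/seteqP; split=> p.
  case=> [Hp|[c' /= c'C c'p]]; first by right; left.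
  have [<-|/eqP c'c] := eqVneq c' c; first by left.
  by right; right; exists c'.
by case=> [cp|[Hp|[c' [c'C _] c'p]]]; [right; exists c|left|right; exists c'].
Qed.

Lemma convex_subdivision_cells :
  plane_graph V E -> has_interior (~` outer hull) -> convex_subdivision V E.
Proof.
move=> plane intH; split=> // F /face_hull_or_cell[->|[c cC ->]].
(* This point is too far to lie in the hull, and too far for the alleged bound [M] on the
   outside. *)
- case=> M HM; pose p : pt := (`|M| + `|B| + 1, 0).
  have p1 : `|p.1| = `|M| + `|B| + 1.
    by rewrite /p /= ger0_norm ?addr_ge0 // ?normr_ge0.
  have [/HM[]|/bounded_hull[]] := pselect (outer hull p); rewrite p1 => h _.
    by have := ler_norm M; have := normr_ge0 B; lra.
  by have := ler_norm B; have := normr_ge0 M; lra.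
- by move=> _; exact: convex_inner.
- by move=> _; split=> //; exact: convex_setC_outer.
- by case; exists B => p /(cells_hull cC); exact: bounded_hull.
Qed.

End Faces.

(** * Drifting subdivisions of a segment *)

Section Drift.
Variable R : realType.
Local Notation pt := (R * R)%type.
Implicit Types (p q : pt) (x y : R).

Lemma comb0 p q : comb 0 p q = p.
Proof. by rewrite /comb subr0 !mul0r !addr0 !mul1r -surjective_pairing. Qed.

Lemma comb1 p q : comb 1 p q = q.
Proof. by rewrite /comb subrr !mul0r !add0r !mul1r -surjective_pairing. Qed.

Lemma combC x p q : comb (1 - x) p q = comb x q p.
Proof. by rewrite /comb; congr pair; ring. Qed.

Lemma comb_comb x y z p q :
  comb x (comb y p q) (comb z p q) = comb ((1 - x) * y + x * z) p q.
Proof. by rewrite /comb /=; congr pair; ring. Qed.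

Lemma comb_inj p q x y : p != q -> comb x p q = comb y p q -> x = y.
Proof.
move=> pq [] h1 h2; apply/eqP/negPn/negP => xy; move/eqP: pq; apply.
rewrite [p]surjective_pairing [q]surjective_pairing.
have nz : x - y != 0 by rewrite subr_eq0.
by congr pair; apply: (mulfI nz); lra.
Qed.

(* Inner points number 1 to [m.+2] of a subdivision of [p, q] into [m.+3]
   pieces; [A] drifts towards [q] at all of them but the first and the last. *)
Definition drift (A : routing_alg R) (t p q : pt) (m : nat) :=
  exists lam : nat -> R, [/\ lam 0 = 0, lam m.+3 = 1,
    forall i, (i < m.+3)%N -> lam i < lam i.+1 &
    forall i, (1 < i < m.+2)%N ->
      2^-1 <= rprob A (comb (lam i) p q) t
        [fset comb (lam i.-1) p q; comb (lam i.+1) p q]%fset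
        (comb (lam i.+1) p q)].

(** Choose points of the segment increasing towards [q], and colour a triple by whether its middle
    point moves to the later one with probability at least 1/2. A monochromatic sequence drifts
    towards [q] or, read backwards, towards [p]. *)
Lemma drift_dichotomy A t p q m : p != q -> drift A t p q m \/ drift A t q p m.
Proof.
move=> pq; pose lam0 (n : nat) : R := 1 - (n%:R + 2)^-1.
have pos n : 0 < n%:R + 2 :> R by rewrite ltr_wpDl.
have lam0_gt0 n : 0 < lam0 n.
  by rewrite subr_gt0 invf_lt1 // (lt_le_trans (y := 2)) ?lerDr // ltr1n.
have lam0_lt1 n : lam0 n < 1 by rewrite gtrBl invr_gt0.
have lam0_lt i j : (i < j)%N -> lam0 i < lam0 j.
  by move=> ij; rewrite ltrD2l ltrN2 ltf_pV2 ?posrE // ltrD2r ltr_nat.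
pose x n := comb (lam0 n) p q.
have x_inj i j : (i < j)%N -> x i != x j.
  by move=> ij; apply/eqP => /(comb_inj pq) e; have := lam0_lt _ _ ij; rewrite e ltxx.
have [y [b [ylt ycol]]] := monochromatic_consecutive_triples
  (fun i j l => 2^-1 <= rprob A (x j) t [fset x i; x l]%fset (x l)).
case: b ycol => ycol; [left|right].
  (* Terms 0 to [m.+1] of the sequence become inner points 1 to [m.+2]. The first and the last of
     these have [p] or [q] as a neighbour, about which the colouring says nothing. *)
  exists (fun i => if i is j.+1 then if (j < m.+2)%N then lam0 (y j) else 1 else 0).
  split=> // [|[|j] im|[|[|j]]//= im]; rewrite ?ltnn //=.
  - rewrite (_ : (j < m.+2)%N); last by lia.
    by case: ifP => _; [exact: lam0_lt|exact: lam0_lt1].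
  - by rewrite !ifT ?ycol //; lia.
(* Seen from [q] the order is reversed: inner point [j.+1] is term [m.+1 - j]. *)
exists (fun i => if i is j.+1 then
  if (j < m.+2)%N then 1 - lam0 (y (m.+1 - j)%N) else 1 else 0).
split=> // [|[|j] im|[|[|j]]//= im]; rewrite ?ltnn ?subr_gt0 //=.
- rewrite (_ : (j < m.+2)%N); last by lia.
  case: ifP => jm; last by rewrite gtrBl.
  by rewrite ltrD2l ltrN2 -(@subnSK j m.+1 jm); exact: lam0_lt.
- rewrite !ifT; [|lia..].
  rewrite !(combC (lam0 _)) -!/(x _).
  have -> : (m.+1 - j = (m.+1 - j.+2).+2)%N by lia.
  have -> : (m.+1 - j.+1 = (m.+1 - j.+2).+1)%N by lia.
  move: (m.+1 - j.+2)%N => n.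
  (* The move to the later point has probability below 1/2, and the two probabilities sum to 1. *)
  have /negbT := ycol n; rewrite -ltNge fsetUC => lt2.
  have x02 : x (y n) != x (y n.+2) by apply: x_inj; exact: ltn_trans (ylt _) (ylt _).
  have N0 : [fset x (y n.+2); x (y n)]%fset != fset0.
    by apply/fset0Pn; exists (x (y n)); rewrite !inE eqxx orbT.
  have := rprob_sum1 A (x (y n.+1)) t N0.
  have nin : x (y n.+2) \notin [fset x (y n)]%fset by rewrite inE eq_sym.
  by rewrite big_fsetU1 //= big_seq_fset1 ; lra.
Qed.

End Drift.

(** * Subdivided drawings and the time to route through them *)

Section Subdivision.
Variable R : realType.
Local Notation pt := (R * R)%type.
Implicit Types (p q v w : pt) (e f : pt * pt) (x y : R) (i j : nat).

(* The drawing to be subdivided: [es] lists its edges; edge [e] is cut into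
   [len e] pieces at the points of parameters [par e i]. *)
Variables (es : seq (pt * pt)) (len : pt * pt -> nat) (par : pt * pt -> nat -> R).

Definition node e i := comb (par e i) e.1 e.2.

Definition subdiv_vertices : {fset pt} :=
  [fset v in [seq node e i | e <- es, i <- iota 0 (len e).+1]]%fset.

Definition subdiv_edges : {fset pt * pt} :=
  [fset e' in [seq (node e i, node e i.+1) | e <- es, i <- iota 0 (len e)]]%fset.

Definition meet_at_endpoints (r : seq (pt * pt)) := forall e f p,
  e \in r -> f \in r -> e != f -> seg e.1 e.2 p -> seg f.1 f.2 p ->
  p \in [:: e.1; e.2] /\ p \in [:: f.1; f.2].

Hypothesis es_neq : forall e, e \in es -> e.1 != e.2.
Hypothesis es_meet : meet_at_endpoints es.
Hypothesis len_gt0 : forall e, (0 < len e)%N.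
Hypothesis par0 : forall e, par e 0 = 0.
Hypothesis par1 : forall e, par e (len e) = 1.
Hypothesis par_lt : forall e i, (i < len e)%N -> par e i < par e i.+1.

Lemma subdiv_verticesP v : reflect
  (exists e i, [/\ e \in es, (i <= len e)%N & v = node e i])
  (v \in subdiv_vertices).
Proof.
rewrite inE; apply: (iffP allpairsPdep) => -[e [i [ees il ->]]]; exists e, i;
  by move: il; rewrite mem_iota.
Qed.

Lemma subdiv_edgesP e' : reflect
  (exists e i, [/\ e \in es, (i < len e)%N & e' = (node e i, node e i.+1)])
  (e' \in subdiv_edges).
Proof.
rewrite inE; apply: (iffP allpairsPdep) => -[e [i [ees il ->]]]; exists e, i;
  by move: il; rewrite mem_iota.
Qed.

Lemma ltr_par e i j : (i < j <= len e)%N -> par e i < par e j.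
Proof.
elim: j => // j IH; rewrite ltnS leq_eqVlt => /andP[/predU1P[->|ij] jl].
  exact: par_lt.
by apply: lt_trans (par_lt jl); apply: IH; rewrite ij ltnW.
Qed.

Lemma ler_par e i j : (i <= j <= len e)%N -> par e i <= par e j.
Proof.
by rewrite leq_eqVlt => /andP[/predU1P[->//|ij] jl]; rewrite ltW // ltr_par ?ij.
Qed.

Lemma par_inj e i j :
  (i <= len e)%N -> (j <= len e)%N -> par e i = par e j -> i = j.
Proof.
move=> il jl; have [ij|ji|//] := ltngtP i j => eq_par.
  by have := @ltr_par e i j; rewrite eq_par ltxx ij jl => /(_ isT).
by have := @ltr_par e j i; rewrite eq_par ltxx ji il => /(_ isT).
Qed.

Lemma par_itv e i : (i <= len e)%N -> 0 <= par e i <= 1.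
Proof.
by move=> il; rewrite -{1}(par0 e) -(par1 e) !ler_par ?il ?leqnn.
Qed.

Lemma node0 e : node e 0 = e.1. Proof. by rewrite /node par0 comb0. Qed.

Lemma node_len e : node e (len e) = e.2. Proof. by rewrite /node par1 comb1. Qed.

Lemma node_inj e i j : e \in es -> (i <= len e)%N -> (j <= len e)%N ->
  node e i = node e j -> i = j.
Proof. by move=> /es_neq ne il jl /(comb_inj ne); exact: par_inj. Qed.

Lemma seg_node e i : (i <= len e)%N -> seg e.1 e.2 (node e i).
Proof. by move=> il; exists (par e i); rewrite //= in_itv /= par_itv. Qed.

Lemma seg_subdiv_edge e i p : (i < len e)%N -> seg (node e i) (node e i.+1) p ->
  exists2 x, par e i <= x <= par e i.+1 & p = comb x e.1 e.2.
Proof.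
move=> il [l /=]; rewrite in_itv /= => /andP[l0 l1] <-.
exists ((1 - l) * par e i + l * par e i.+1); last by rewrite comb_comb.
by have := par_lt il; nra.
Qed.

Lemma seg_subdiv_edge_sub e i : (i < len e)%N ->
  seg (node e i) (node e i.+1) `<=` seg e.1 e.2.
Proof.
move=> il p /(seg_subdiv_edge il)[x xi ->]; exists x => //=.
rewrite in_itv /=; have := par_itv il; have := par_itv (ltnW il); lra.
Qed.

Lemma subdiv_edge_endpoint e i p : e \in es -> (i < len e)%N ->
  seg (node e i) (node e i.+1) p -> p \in [:: e.1; e.2] ->
  p \in [:: node e i; node e i.+1].
Proof.
move=> ees il /(seg_subdiv_edge il)[x xi ->]; rewrite !inE.
have ne := es_neq ees.
case/orP => /eqP; [rewrite -{2}(comb0 e.1 e.2)|rewrite -{2}(comb1 e.1 e.2)].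
  move=> /(comb_inj ne) x0; apply/orP; left; rewrite x0 comb0 -node0.
  rewrite (_ : i = 0)%N //; apply: (@par_inj e) => //; first exact: ltnW.
  by have := par_itv (ltnW il); rewrite par0; lra.
move=> /(comb_inj ne) x1; apply/orP; right; rewrite x1 comb1 -node_len.
rewrite (_ : len e = i.+1)%N //; apply: (@par_inj e) => //.
by have := par_itv il; rewrite par1; lra.
Qed.

(** Pieces of distinct edges can only meet at endpoints of these edges. On one edge the parameters
    increase, so only consecutive pieces meet, at their common node. *)
Lemma subdiv_edge_meet e f i j p : e \in es -> f \in es ->
  (i < len e)%N -> (j < len f)%N -> (e, i) != (f, j) ->
  seg (node e i) (node e i.+1) p -> seg (node f j) (node f j.+1) p ->
  p \in [:: node e i; node e i.+1] /\ p \in [:: node f j; node f j.+1].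
Proof.
move=> ees fes il jl; have [ef|ef _ pe pf] := eqVneq e f; last first.
  have [pe' pf'] := es_meet ees fes ef (seg_subdiv_edge_sub il pe)
    (seg_subdiv_edge_sub jl pf).
  by split; apply: subdiv_edge_endpoint.
move: jl; rewrite -{f fes}ef xpair_eqE eqxx /= => jl.
wlog ij : i j il jl / (i < j)%N => [hw|_].
  rewrite neq_ltn => /orP[ij|ji] pi pj; first by apply: hw => //; lia.
  by apply/and_comm; apply: hw => //; lia.
move=> /(seg_subdiv_edge il)[x xi px] /(seg_subdiv_edge jl)[y yj py].
have xy : x = y by apply: (comb_inj (es_neq ees)); rewrite -px -py.
have le_ij : par e i.+1 <= par e j by rewrite ler_par // ij ltnW.
have Eij : i.+1 = j by apply: (@par_inj e) => //; [exact: ltnW|lra].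
have Ex : x = par e j by rewrite -Eij; move: le_ij; rewrite -Eij in yj *; lra.
by rewrite px Ex Eij !inE eqxx orbT.
Qed.

Lemma subdiv_plane : plane_graph subdiv_vertices subdiv_edges.
Proof.
have cross e f : e \in subdiv_edges -> f \in subdiv_edges -> ~ same_edge e f ->
    seg e.1 e.2 `&` seg f.1 f.2 `<=` [set e.1; e.2] `&` [set f.1; f.2].
  move=> /subdiv_edgesP[e' [i [ees il ->]]] /subdiv_edgesP[f' [j [fes jl ->]]] /=.
  move=> nse p [pe pf].
  have ne : (e', i) != (f', j) by apply/eqP => -[ee ii]; apply: nse; rewrite ee ii; left.
  have [] := subdiv_edge_meet ees fes il jl ne pe pf.
  by rewrite !inE => /orP[]/eqP-> /orP[]/eqP ->; split; (by left) || (by right).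
have neq e : e \in subdiv_edges -> e.1 != e.2.
  move=> /subdiv_edgesP[e' [i [ees il ->]]] /=.
  by apply/eqP => /(node_inj ees (ltnW il) il)/n_Sn.
split=> // [e ee|v e].
  split; last exact: neq.
    by case/subdiv_edgesP: ee => e' [i [? ? ->]]; apply/subdiv_verticesP;
      exists e', i; split=> //; exact: ltnW.
  by case/subdiv_edgesP: ee => e' [i [? ? ->]]; apply/subdiv_verticesP;
    exists e', i.+1; split.
move=> /subdiv_verticesP[f [i [fes il ->{v}]]] ee [l /= l01 E].
(* Every node is an end of some piece [f']. As pieces meet only at ends, a node on a piece [e] is an
   end of [e], hence not in its open segment. *)
have [f' f'E fv] : exists2 f', f' \in subdiv_edges & node f i \in [:: f'.1; f'.2].
  move: il; rewrite leq_eqVlt => /predU1P[->|il].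
    exists (node f (len f).-1, node f (len f)); last by rewrite !inE eqxx orbT.
    apply/subdiv_edgesP; exists f, (len f).-1.
    by rewrite prednK ?len_gt0 // leqnn.
  exists (node f i, node f i.+1); last by rewrite !inE eqxx.
  by apply/subdiv_edgesP; exists f, i.
have : node f i \in [:: e.1; e.2].
  have [[[-> ->]|[-> ->]]|nse] := pselect (same_edge e f'); first exact: fv.
    by move: fv; rewrite !inE orbC.
  have [|[]->] := cross e f' ee f'E nse (node f i); rewrite ?inE ?eqxx ?orbT //.
  split.
    exists l => //=; apply: subset_itvW l01; exact: lexx.
  move: fv; rewrite !inE => /orP[]/eqP ->.
    by exists 0; rewrite ?comb0 //= in_itv /= lexx ler01.
  by exists 1; rewrite ?comb1 //= in_itv /= lexx ler01.
have ne := neq e ee; move: l01; rewrite in_itv /= => l01.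
rewrite -E !inE => /orP[]/eqP; [rewrite -{2}(comb0 e.1 e.2)|rewrite -{2}(comb1 e.1 e.2)];
  by move=> /(comb_inj ne); lra.
Qed.

Lemma subdiv_drawing p : drawing subdiv_vertices subdiv_edges p <->
  exists2 e, e \in es & seg e.1 e.2 p.
Proof.
split=> [[|[e' /=]]|[e ees [x /=]]].
- by move=> /subdiv_verticesP[e [i [ees il ->]]]; exists e => //; exact: seg_node.
- move=> /subdiv_edgesP[e [i [ees il ->]]] pe; exists e => //.
  exact: seg_subdiv_edge_sub pe.
rewrite in_itv /= => /andP[x0 x1] <-.
(* Descend from the last node until a piece starts below [x], or piece 0 is reached. *)
have [i il xi] : exists2 i, (i < len e)%N & par e i <= x <= par e i.+1.
  have : x <= par e (len e) by rewrite par1.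
  elim: (len e) {-2}(len e) (leqnn (len e)) (len_gt0 e) => [|n IH] [|k] //.
  rewrite ltnS => kn _ xk; have [xk'|] := lerP x (par e k); last first.
    by move=> /ltW xk'; exists k => //; rewrite xk'.
  case: k kn xk xk' => [|k] kn xk xk'.
    by exists 0%N => //; rewrite par0 x0.
  by have [i ik xi] := IH _ kn isT xk'; exists i => //; exact: ltnW.
right; exists (node e i, node e i.+1); first by apply/subdiv_edgesP; exists e, i.
have d0 := par_lt il.
have nz : par e i.+1 - par e i != 0 by rewrite subr_eq0 gt_eqF.
exists ((x - par e i) / (par e i.+1 - par e i)).
  rewrite /= in_itv /= divr_ge0 ?subr_ge0; [|lra..].
  by rewrite ler_pdivrMr ?subr_gt0 // mul1r lerD2r; lra.
by rewrite /= comb_comb; congr comb; field.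
Qed.

Lemma card_subdiv_vertices_le m : (forall e, (len e <= m)%N) ->
  (#|` subdiv_vertices| <= size es * m.+1)%N.
Proof.
move=> lenm; rewrite card_fseq (leq_trans (size_undup _)) //.
rewrite size_allpairs_dep; elim: (es) => //= e r IH.
by rewrite mulSn leq_add // size_iota ltnS.
Qed.

Lemma card_subdiv_vertices_ge e : e \in es -> (len e <= #|` subdiv_vertices|)%N.
Proof.
move=> ees; apply: (@leq_trans (size [seq node e i | i <- iota 0 (len e)])).
  by rewrite size_map size_iota.
rewrite -[X in (size X <= _)%N]undup_id -?card_fseq.
  apply/fsubset_leq_card/fsubsetP => v; rewrite inE => /mapP[i + ->].
  rewrite mem_iota /= add0n => il.
  by apply/subdiv_verticesP; exists e, i; rewrite ltnW.
rewrite map_inj_in_uniq ?iota_uniq // => i j; rewrite !mem_iota /= add0n.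
by move=> il jl; apply: node_inj => //; exact: ltnW.
Qed.


(** An inner node of an edge lies on no other edge, so the algorithm sees there exactly the
    neighbour set that [drift] speaks of. *)
Lemma nbrs_node e i : e \in es -> (0 < i < len e)%N ->
  nbrs subdiv_vertices subdiv_edges (node e i) =
  [fset node e i.-1; node e i.+1]%fset.
Proof.
move=> ees /andP[i0 il].
have unique f j : f \in es -> (j <= len f)%N -> node f j = node e i ->
    f = e /\ j = i.
  move=> fes jl E; have [fe|fe] := eqVneq f e.
    by move: E jl; rewrite fe => E jl; split=> //; apply: node_inj E => //; exact: ltnW.
  have pf : seg f.1 f.2 (node e i) by rewrite -E; exact: seg_node.
  have [_] := es_meet fes ees fe pf (seg_node (ltnW il)).
  rewrite !inE => /orP[]/eqP; rewrite -?node0 -?node_len.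
    by move=> /(node_inj ees (ltnW il) (leq0n _)) Ei; move: i0; rewrite Ei.
  by move=> /(node_inj ees (ltnW il) (leqnn _)) Ei; move: il; rewrite Ei ltnn.
apply/fsetP => w; rewrite in_nbrs in_fset2 /adj; apply/andP/orP.
  move=> [_ /orP[]/subdiv_edgesP[f [j [fes jl]]] /pair_equal_spec[Ev Ew]].
    have [fe ji] := unique f j fes (ltnW jl) (esym Ev).
    by right; rewrite Ew fe ji.
  have [fe ji] := unique f j.+1 fes jl (esym Ew).
  by left; rewrite Ev -ji fe.
case=> /eqP ->; split.
- by apply/subdiv_verticesP; exists e, i.-1; split=> //; lia.
- apply/orP; right; apply/subdiv_edgesP; exists e, i.-1; rewrite prednK //.
  by split=> //; lia.
- by apply/subdiv_verticesP; exists e, i.+1.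
- by apply/orP; left; apply/subdiv_edgesP; exists e, i.
Qed.

Lemma nbrs_neq0 v :
  v \in subdiv_vertices -> nbrs subdiv_vertices subdiv_edges v != fset0.
Proof.
move=> /subdiv_verticesP[e [i [ees il ->]]]; apply/fset0Pn.
move: il; rewrite leq_eqVlt => /predU1P[->|il]; [exists (node e (len e).-1)|
  exists (node e i.+1)]; rewrite in_nbrs; apply/andP; split.
- by apply/subdiv_verticesP; exists e, (len e).-1; rewrite leq_pred.
- apply/orP; right; apply/subdiv_edgesP; exists e, (len e).-1.
  by rewrite prednK ?len_gt0 ?leqnn.
- by apply/subdiv_verticesP; exists e, i.+1.
- by apply/orP; left; apply/subdiv_edgesP; exists e, i.
Qed.

(* Vertices of the core have level 0 and the other endpoints of edges have
   level [m.+1]; the edges joining the two kinds carry the drifting paths,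
   along which the level rises by unit steps. *)
Variables (core : pred pt) (m : nat) (A : routing_alg R) (t : pt).

Definition path_edge e := core e.1 && ~~ core e.2.

Hypothesis core_src : forall e, e \in es -> core e.2 -> core e.1.
Hypothesis len_path : forall e, len e = if path_edge e then m.+3 else 1%N.
Hypothesis par_drift : forall e i, e \in es -> path_edge e -> (1 < i < m.+2)%N ->
  2^-1 <= rprob A (node e i) t [fset node e i.-1; node e i.+1]%fset (node e i.+1).

Definition endpoint_level p := if core p then 0%N else m.+1.

(** On a path, nodes 0 and 1 have level 0, and nodes [m.+2] and [m.+3] have level [m.+1]. The two
    inner nodes without a drift guarantee are thus at the extreme levels. An edge left whole joins
    two endpoints of equal level. *)
Definition node_level e i :=
  if path_edge e then minn i.-1 m.+1 else endpoint_level e.1.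

Lemma node_level_endpoint e i : e \in es -> (i <= len e)%N ->
  node e i \in [:: e.1; e.2] -> node_level e i = endpoint_level (node e i).
Proof.
move=> ees il; rewrite !inE => /orP[]/eqP.
  rewrite -node0 => /node_inj -> //; rewrite node0 /node_level /endpoint_level.
  by rewrite /path_edge; case: (core e.1) => //=; case: ifP; rewrite // min0n.
rewrite -node_len => /node_inj -> //; rewrite node_len len_path.
have := core_src ees; rewrite /node_level /endpoint_level /path_edge.
by case: (core e.1); case: (core e.2) => //= H; [lia|have := H isT].
Qed.

(** A node shared by two edges is an endpoint of both, and the level of an endpoint depends only on
    the point. *)
Lemma node_level_eq e f i j : e \in es -> f \in es -> (i <= len e)%N ->
  (j <= len f)%N -> node e i = node f j -> node_level e i = node_level f j.
Proof.
move=> ees fes il jl E; have [ef|ef] := eqVneq e f.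
  by move: jl E; rewrite -ef => jl /node_inj ->.
have pe : seg f.1 f.2 (node e i) by rewrite E; exact: seg_node.
have [pe1 pf1] := es_meet ees fes ef (seg_node il) pe.
by rewrite !node_level_endpoint -?E.
Qed.

Definition level v := xget 0%N [set n | exists e i,
  [/\ e \in es, (i <= len e)%N, v = node e i & n = node_level e i]].

Lemma level_node e i : e \in es -> (i <= len e)%N ->
  level (node e i) = node_level e i.
Proof.
move=> ees il; rewrite /level; case: xgetP => [_ _ [f [j [fes jl E ->]]]|H].
  by symmetry; exact: node_level_eq.
by case: (H (node_level e i)); exists e, i.
Qed.

Lemma level_le v : v \in subdiv_vertices -> (level v <= m.+1)%N.
Proof.
move=> /subdiv_verticesP[e [i [ees il ->]]]; rewrite level_node // /node_level.
by case: ifP => _; [exact: geq_minr|rewrite /endpoint_level; case: ifP].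
Qed.

Lemma level_nbrs v w : w \in nbrs subdiv_vertices subdiv_edges v ->
  (level v <= (level w).+1)%N.
Proof.
rewrite in_nbrs /adj => /andP[_ /orP[]] /subdiv_edgesP[e [i [ees il]]];
  move=> /pair_equal_spec[-> ->];
  rewrite !level_node ?(ltnW il) // /node_level;
  case: ifP => _; rewrite ?leqnSn //; lia.
Qed.

(** Upward drift can only delay the descent, so the potential [g] of the reflected symmetric walk
    still bounds the time from below. The factor 1/2 comes from [potential_le_expected_steps]. *)
Lemma subdiv_expected_steps e : e \in es -> path_edge e ->
    core t -> (exists2 f, f \in es & t = f.1) ->
  (((m.+1)%:R ^+ 2 / 2)%:E <=
    expected_steps A subdiv_vertices subdiv_edges e.2 t)%E.
Proof.
move=> ees pe ct [f fes tf].
pose K : R := (m.+1)%:R.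
(* [x * (2 * K - x)] is the expected time to descend from level [x] to 0 of the
   symmetric walk reflected at level [K]. *)
pose g v : R := (level v)%:R * (2 * K - (level v)%:R).
have gE n : n%:R * (2 * K - n%:R) = K ^+ 2 - (K - n%:R) ^+ 2 by ring.
have lK v : v \in subdiv_vertices -> (level v)%:R <= K.
  by move=> /level_le; rewrite ler_nat.
have lev_t : level t = 0%N.
  by rewrite tf -node0 level_node // node_level_endpoint ?node0 ?inE ?eqxx //
    /endpoint_level -tf ct.
have lev_e : level e.2 = m.+1.
  rewrite -node_len level_node // node_level_endpoint ?node_len ?inE ?eqxx ?orbT //.
  by rewrite /endpoint_level (negbTE (andP pe).2).
have -> : (m.+1)%:R ^+ 2 = g e.2 by rewrite /g lev_e /K; ring.
apply: (@potential_le_expected_steps _ _ _ _ _ _ _ (m.+1 ^ 2)).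
- by rewrite /g lev_t mul0r.
- by move=> v /lK vK; rewrite /g natrX gE lerBlDr lerDl sqr_ge0.
- move=> v vV vt; set N := nbrs _ _ v.
  have g_ge0 w : w \in N -> 0 <= g w.
    move=> /nbrs_sub /lK wK; have := ler0n R (level w).
    by rewrite /g => ?; rewrite mulr_ge0 //; lra.
  have [lv0|lv0] := posnP (level v).
    rewrite /g lv0 mul0r addr_ge0 // big_seq sumr_ge0 // => w wN.
    by rewrite mulr_ge0 ?rprob_ge0 ?g_ge0.
  (* From the top level any move loses at most one level, hence at most 1 of potential. *)
  have [lvK|lvK] := eqVneq (level v) m.+1.
    apply: (@le_trans _ _ (1 + \sum_(w <- N) rprob A v t N w * (K ^+ 2 - 1))).
      rewrite -mulr_suml rprob_sum1 ?nbrs_neq0 // mul1r /g lvK -/K; lra.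
    rewrite lerD2l big_seq [leRHS]big_seq; apply: ler_sum => w wN.
    rewrite ler_wpM2l ?rprob_ge0 // /g gE lerD2l lerN2.
    have wK := lK w (nbrs_sub wN); rewrite expr_le1 ?subr_ge0 //.
    have := level_nbrs wN; rewrite lvK ltnS -(ler_nat R) => mw.
    by rewrite /K -natr1; lra.
  (* At an intermediate level, [v] is inner node [j.+2] of a path, and its neighbours have levels
     [j] and [j.+2]. *)
  have /subdiv_verticesP[f' [i [f'es il vE]]] := vV.
  have lvE : level v = node_level f' i by rewrite vE level_node.
  have pf' : path_edge f'.
    move: lv0 lvK; rewrite lvE /node_level /endpoint_level.
    by case: ifP => // _; case: ifP => // _; rewrite eqxx.
  have [j jm iE] : exists2 j, (j < m)%N & i = j.+2.
    move: lv0 lvK; rewrite lvE /node_level pf'.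
    case: (i) => [|[|j]] /=; rewrite ?min0n // => _ h; exists j => //.
    by rewrite ltnNge; apply: contra h => mj; rewrite (minn_idPr _).
  rewrite {}iE in il vE lvE.
  have jl : (j.+3 <= len f')%N by rewrite len_path pf' !ltnS ltnW.
  have := par_drift (i := j.+2) f'es pf' jm.
  have := rprob_sum1 A v t (nbrs_neq0 vV).
  rewrite /N /g lvE vE nbrs_node //=.
  have ne : node f' j.+1 \notin [fset node f' j.+3]%fset.
    rewrite in_fset1; apply/eqP => E.
    by have /esym/eqP := node_inj f'es (ltnW il) jl E; rewrite gtn_eqF.
  rewrite !big_fsetU1 //= !big_seq_fset1 !level_node //; last exact: ltnW.
  rewrite /node_level pf' /= !(minn_idPl _) ?ltnS // 1?ltnW //; last exact: ltnW.
  have : j.+2%:R <= K :> R by rewrite ler_nat.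
  rewrite -[j.+2%:R]natr1 -[j.+1%:R]natr1.
  move: j%:R (rprob _ _ _ _ _) (rprob _ _ _ _ _).
  move=> L pb pa LK sum1 pb2; have -> : pa = 1 - pb by lra.
  (* The slack in the drift inequality is four times this product. *)
  have : 0 <= (K - (L + 1)) * (pb - 2^-1) by rewrite mulr_ge0 ?subr_ge0 //; lra.
  lra.
- by apply/subdiv_verticesP; exists e, (len e); rewrite node_len.
Qed.

End Subdivision.

(** * Integer figures and their decidable certificates *)

Local Notation ipt := (int * int)%type.

(* Certificate that the segments [e] and [f] meet in common endpoints only:
   one lies strictly on one side of the other, or has a single point on the
   line of the other, which is an endpoint of both, or a line of [aux]
   separates them weakly and contains neither. *)
Definition meet_certificate (aux : seq (ipt * ipt)) (e f : ipt * ipt) : bool :=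
  let one_side e f := 0 < side e f.1 * side e f.2 in
  let touch e f :=
    [&& side e f.1 == 0, side e f.2 != 0 & f.1 \in [:: e.1; e.2]] ||
    [&& side e f.2 == 0, side e f.1 != 0 & f.2 \in [:: e.1; e.2]] in
  let separates l :=
    [&& side l e.1 <= 0, side l e.2 <= 0, 0 <= side l f.1, 0 <= side l f.2,
        side l e.1 + side l e.2 != 0 & side l f.1 + side l f.2 != 0] in
  let separated l := separates l || separates (l.2, l.1) in
  [|| one_side e f, one_side f e, touch e f, touch f e | has separated aux].

(** Collinearity, together with bounds on the scalar product with [b - a], keeps the test within the
    integers. *)
Definition between (a m b : ipt) : bool :=
  (side (a, b) m == 0) &&
  (0 <= (m.1 - a.1) * (b.1 - a.1) + (m.2 - a.2) * (b.2 - a.2)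
     <= (b.1 - a.1) ^+ 2 + (b.2 - a.2) ^+ 2).

(* [n] bounds the number of successive splittings of the segment [a, b]. *)
Fixpoint seg_covered (n : nat) (es : seq (ipt * ipt)) (a b : ipt) : bool :=
  [|| (a, b) \in es, (b, a) \in es | if n is n'.+1 then
    has (fun m => [&& a != b, between a m b, seg_covered n' es a m &
      seg_covered n' es m b]) (map snd es) else false].

(* Inside the closed cell cut out by [d], the line [l] is confined to the
   segment [l.1, l.2], which is drawn. *)
Definition side_drawn (es d : seq (ipt * ipt)) (l : ipt * ipt) : bool :=
  [&& l.1 != l.2, seg_covered 2 es l.1 l.2,
    has (fun l' => (0 < side l' l.1) && (side l' l.2 <= 0)) d &
    has (fun l' => (side l' l.1 <= 0) && (0 < side l' l.2)) d].

(* The outer face is the complement of the closed polygon [hull], around the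
   point [c]; a cell is the open region to the left of a list of lines, which
   includes [hull]. The edges to be replaced by paths are those that leave
   [core]. *)
Definition figure_check (es hull aux : seq (ipt * ipt))
    (cells : seq (seq (ipt * ipt))) (core : seq ipt) (c t : ipt) : bool :=
  [&& all (fun e => e.1 != e.2) es,
      all (fun e => all (fun f => (e == f) || meet_certificate aux e f) es) es,
      all (fun e => (e.2 \in core) ==> (e.1 \in core)) es,
      all (fun e => all (fun l => (0 <= side l e.1) && (0 <= side l e.2)) hull) es,
      all (fun e => all (has (fun l => (side l e.1 <= 0) && (side l e.2 <= 0)))
        cells) es,
      all (fun d => all (fun d' : seq (ipt * ipt) =>
        (d == d') || has (fun l => (l.2, l.1) \in d') d) cells) cells,
      all (fun d : seq (ipt * ipt) => all (mem d) hull && all (side_drawn es d) d)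
        cells,
      all (fun l => 0 < side l c) hull && sorted (fun l l' => l.2 == l'.1) hull,
      has (fun e => (e.1 \in core) && (e.2 \notin core)) es &
      (t \in core) && has (fun e => e.1 == t) es].

(** * From checked figures to slow subdivisions *)

Section Figure.
Variable R : realType.
Local Notation pt := (R * R)%type.

Definition emb (p : ipt) : pt := (p.1%:~R, p.2%:~R).
Definition emb2 (l : ipt * ipt) : pt * pt := (emb l.1, emb l.2).

Lemma emb_inj : injective emb.
Proof. by move=> [a b] [c d] [/intr_inj/= -> /intr_inj/= ->]. Qed.

Lemma side_emb l p : side (emb2 l) (emb p) = (side l p)%:~R.
Proof. by rewrite /side /= !(rmorphB, rmorphM). Qed.

Lemma seg_comb (a b p : pt) : seg a b p ->
  exists2 x, 0 <= x <= 1 & p = comb x a b.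
Proof. by move=> [x]; rewrite /= in_itv /= => x01 <-; exists x. Qed.

Lemma meet_certificateP aux e f (p : pt) : meet_certificate aux e f ->
  seg (emb e.1) (emb e.2) p -> seg (emb f.1) (emb f.2) p ->
  p \in [:: emb e.1; emb e.2] /\ p \in [:: emb f.1; emb f.2].
Proof.
have on_line e' q : seg (emb e'.1) (emb e'.2) q -> side (emb2 e') q = 0.
  by move=> /seg_comb[x _ ->]; rewrite side_comb /side /=; ring.
(* An affine function that is nonpositive at both ends, and not zero at both, can vanish only at an
   end. *)
have endpoint l e' q : side l e'.1 <= 0 -> side l e'.2 <= 0 ->
    side l e'.1 + side l e'.2 != 0 -> seg (emb e'.1) (emb e'.2) q ->
    side (emb2 l) q <= 0 /\ (side (emb2 l) q = 0 -> q \in [:: emb e'.1; emb e'.2]).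
  move=> s1 s2 ne /seg_comb[x x01 ->]; rewrite side_comb !side_emb.
  have {}s1 : (side l e'.1)%:~R <= 0 :> R by rewrite lerz0.
  have {}s2 : (side l e'.2)%:~R <= 0 :> R by rewrite lerz0.
  have {}ne : (side l e'.1)%:~R + (side l e'.2)%:~R != 0 :> R.
    by rewrite -intrD intr_eq0.
  split=> [|x_eq]; first by nra.
  have [h1|h1] := eqVneq ((side l e'.1)%:~R : R) 0.
    have -> : x = 0.
      apply/eqP; rewrite h1 add0r in ne; rewrite h1 mulr0 add0r in x_eq.
      by move/eqP: x_eq; rewrite mulf_eq0 (negbTE ne) orbF.
    by rewrite comb0 !inE eqxx.
  have -> : x = 1.
    move: s1; rewrite le_eqVlt (negbTE h1) /= => s1.
    have y1 : (1 - x) * (side l e'.1)%:~R <= 0 by nra.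
    have y2 : x * (side l e'.2)%:~R <= 0 by nra.
    have /eqP : (1 - x) * (side l e'.1)%:~R = 0 by lra.
    by rewrite mulf_eq0 (negbTE h1) orbF => /eqP; lra.
  by rewrite comb1 !inE eqxx orbT.
(* On [f'] the side is a convex combination of nonzero values of one sign, whereas it vanishes on
   [e']. *)
have oneside e' f' q : 0 < side e' f'.1 * side e' f'.2 ->
    seg (emb e'.1) (emb e'.2) q -> ~ seg (emb f'.1) (emb f'.2) q.
  move=> pos /on_line + /seg_comb[x x01 qE]; rewrite qE side_comb !side_emb.
  have {pos} : 0 < (side e' f'.1)%:~R * (side e' f'.2)%:~R :> R.
    by rewrite -intrM ltr0z.
  move: (_%:~R) (_%:~R) => b a ab E.
  have a0 : a != 0 by apply: contraTneq ab => ->; rewrite mul0r ltxx.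
  have aa : 0 < a * a by rewrite -expr2 exprn_even_gt0.
  have {E} : (1 - x) * (a * a) + x * (a * b) = 0.
    by rewrite -(mulr0 a) -E; ring.
  by move: (a * a) (a * b) aa ab => u v u0 v0 E; have [] := lerP x 2^-1; nra.
have touch e' f' q :
    [&& side e' f'.1 == 0, side e' f'.2 != 0 & f'.1 \in [:: e'.1; e'.2]] ||
    [&& side e' f'.2 == 0, side e' f'.1 != 0 & f'.2 \in [:: e'.1; e'.2]] ->
    seg (emb e'.1) (emb e'.2) q -> seg (emb f'.1) (emb f'.2) q ->
    q \in [:: emb e'.1; emb e'.2] /\ q \in [:: emb f'.1; emb f'.2].
  move=> + /on_line + /seg_comb[x x01 qE]; rewrite qE side_comb !side_emb.
  case/orP=> /and3P[/eqP -> ne end_e]; rewrite mulr0 ?add0r ?addr0 => /eqP;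
    rewrite mulf_eq0 intr_eq0 (negbTE ne) orbF ?subr_eq0 => /eqP Ex.
    rewrite Ex comb0 !inE eqxx; split=> //.
    by move: end_e; rewrite !inE => /orP[]/eqP ->; rewrite eqxx ?orbT.
  rewrite -Ex comb1 !inE eqxx orbT; split=> //.
  by move: end_e; rewrite !inE => /orP[]/eqP ->; rewrite eqxx ?orbT.
case/orP => [h|/orP[h|/orP[h|/orP[h|/hasP[l _ h]]]]] pe pf.
- by case: (oneside _ _ _ h pe pf).
- by case: (oneside _ _ _ h pf pe).
- exact: touch h pe pf.
- by apply/and_comm; exact: touch h pf pe.
have sep l' : [&& side l' e.1 <= 0, side l' e.2 <= 0, 0 <= side l' f.1,
    0 <= side l' f.2, side l' e.1 + side l' e.2 != 0 &
    side l' f.1 + side l' f.2 != 0] ->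
    p \in [:: emb e.1; emb e.2] /\ p \in [:: emb f.1; emb f.2].
  case/and5P=> e1 e2 f1 f2 /andP[ne nf].
  have [le0 He] := endpoint _ _ _ e1 e2 ne pe.
  have [] := endpoint (l'.2, l'.1) f p _ _ _ pf; rewrite ?side_rev ?oppr_le0 //.
    by rewrite -opprD oppr_eq0.
  rewrite (side_rev (emb2 l')) => ge0 Hf.
  have E : side (emb2 l') p = 0 by move: le0 ge0; rewrite oppr_le0; lra.
  by split; [exact: He|apply: Hf; rewrite E oppr0].
by case/orP: h; exact: sep.
Qed.

(** The parameter is that of the orthogonal projection on the line: the scalar product with [b - a]
    over the squared length [n]. *)
Lemma line_comb (a b p : pt) : a != b -> side (a, b) p = 0 ->
  let n := (b.1 - a.1) ^+ 2 + (b.2 - a.2) ^+ 2 in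
  0 < n /\ p =
    comb (((p.1 - a.1) * (b.1 - a.1) + (p.2 - a.2) * (b.2 - a.2)) / n) a b.
Proof.
case: a b p => [a1 a2] [b1 b2] [p1 p2] /= ab; rewrite /side /= => s0.
set n := (b1 - a1) ^+ 2 + (b2 - a2) ^+ 2.
have n0 : 0 < n.
  rewrite lt_neqAle addr_ge0 ?sqr_ge0 // andbT eq_sym paddr_eq0 ?sqr_ge0 //.
  by apply: contra ab; rewrite !sqrf_eq0 !subr_eq0 => /andP[/eqP -> /eqP ->].
have nz : n != 0 by rewrite gt_eqF.
split=> //; rewrite /comb /=; congr pair; symmetry; apply: (mulIf nz);
  rewrite mulrDl -!mulrA.
  have -> : (1 - ((p1 - a1) * (b1 - a1) + (p2 - a2) * (b2 - a2)) / n) * (a1 * n) =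
    a1 * (n - ((p1 - a1) * (b1 - a1) + (p2 - a2) * (b2 - a2))) by field.
  have -> : n^-1 * (b1 * n) = b1 by field.
  have -> : p1 * n = p1 * n + (b2 - a2) * ((b1 - a1) * (p2 - a2) - (b2 - a2) * (p1 - a1)).
    by rewrite s0 mulr0 addr0.
  by rewrite /n; ring.
have -> : (1 - ((p1 - a1) * (b1 - a1) + (p2 - a2) * (b2 - a2)) / n) * (a2 * n) =
  a2 * (n - ((p1 - a1) * (b1 - a1) + (p2 - a2) * (b2 - a2))) by field.
have -> : n^-1 * (b2 * n) = b2 by field.
have -> : p2 * n = p2 * n - (b1 - a1) * ((b1 - a1) * (p2 - a2) - (b2 - a2) * (p1 - a1)).
  by rewrite s0 mulr0 subr0.
by rewrite /n; ring.
Qed.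

Lemma seg_sym (a b p : pt) : seg a b p -> seg b a p.
Proof.
move=> /seg_comb[x x01 ->]; exists (1 - x); last by rewrite combC.
by rewrite /= in_itv /=; lra.
Qed.

Lemma seg_split (a m b p : pt) :
  seg a b m -> seg a b p -> seg a m p \/ seg m b p.
Proof.
have split_le y x : 0 <= x <= y -> forall u v : pt,
    seg u (comb y u v) (comb x u v).
  move=> /andP[x0 xy] u v; have [y0|y0] := eqVneq y 0.
    have -> : x = 0 by lra.
    by rewrite y0; exists 0; rewrite ?comb0 //= in_itv /= lexx ler01.
  have y1 : 0 < y by rewrite lt_neqAle eq_sym y0; lra.
  exists (x / y); first by rewrite /= in_itv /= divr_ge0 ?(ltW y1) // ler_pdivrMr ?mul1r.
  rewrite -[X in comb _ X _](comb0 u v) comb_comb mulr0 add0r.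
  by rewrite divfK.
move=> /seg_comb[y y01 ->] /seg_comb[x x01 ->]; have [xy|yx] := lerP x y.
  by left; apply: split_le; rewrite xy; case/andP: x01 => ->.
right; apply: seg_sym; rewrite -(combC x b a) -(combC y b a).
by apply: split_le; lra.
Qed.

Lemma seg_coveredP n es a b (p : pt) : seg_covered n es a b ->
  seg (emb a) (emb b) p -> exists2 e, e \in es & seg (emb e.1) (emb e.2) p.
Proof.
elim: n a b => [|n IH] a b /= /or3P[h|h|] //; try by exists (a, b).
- by move=> /seg_sym ?; exists (b, a).
- by move=> /seg_sym ?; exists (b, a).
move=> /hasP[m _ /and4P[ab /andP[/eqP s0 /andP[d0 d1]] am mb]].
have m_ab : seg (emb a) (emb b) (emb m).
  have [||n0 ->] := @line_comb (emb a) (emb b) (emb m).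
  - by apply: contra ab => /eqP/emb_inj ->.
  - by rewrite (side_emb (a, b)) s0.
  move: d0 d1; rewrite -(ler0z R) -(ler_int R) !expr2.
  rewrite !(intrD, intrM, mulrNz) => d0 d1.
  set x := (_ / _); exists x => //; rewrite /= in_itv /= /x; apply/andP; split.
    by apply: divr_ge0; [exact: d0|exact: ltW].
  by rewrite ler_pdivrMr ?mul1r.
by move=> /(seg_split m_ab)[/(IH _ _ am)|/(IH _ _ mb)].
Qed.

Lemma closed_cell es d (p : pt) : all (side_drawn es d) d ->
    all (fun l => 0 <= side (emb2 l) p) d ->
  inner (map emb2 d) p \/ exists2 e, e \in es & seg (emb e.1) (emb e.2) p.
Proof.
move=> drawn ge0; have [|/allPn[l ld]] := boolP (all (fun l => 0 < side (emb2 l) p) d).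
  by move=> /allP h; left; apply/allP => _ /mapP[l /h ? ->].
rewrite lt_neqAle (allP ge0 l ld) andbT negbK => /eqP /esym s0; right.
have /and4P[ne cov /hasP[l1 l1d /andP[l11 l12]] /hasP[l2 l2d /andP[l21 l22]]] :=
  allP drawn l ld.
apply: (seg_coveredP cov).
have [||_] := @line_comb (emb l.1) (emb l.2) p.
- by apply: contra ne => /eqP/emb_inj ->.
- by rewrite s0.
move: (_ / _) => x pE.
have := allP ge0 l1 l1d; have := allP ge0 l2 l2d.
rewrite pE !side_comb !side_emb.
have {}l11 : 0 < (side l1 l.1)%:~R :> R by rewrite ltr0z.
have {}l12 : (side l1 l.2)%:~R <= 0 :> R by rewrite lerz0.
have {}l21 : (side l2 l.1)%:~R <= 0 :> R by rewrite lerz0.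
have {}l22 : 0 < (side l2 l.2)%:~R :> R by rewrite ltr0z.
(* If [x] exceeded 1, [l1] would be negative at [p]; if [x] were below 0, [l2] would. *)
move=> h2 h1; exists x => //; rewrite /= in_itv /=.
by apply/andP; split; rewrite leNgt; apply/negP => hx; nra.
Qed.

(** The factor 12 is the number of edges of the pinwheel, and an edge carries at most [m.+4]
    nodes. *)
Definition slow_subdivision (A : routing_alg R) (t : pt) (m : nat) :=
  exists V E s, [/\ convex_subdivision V E, s \in V, t \in V,
    (m <= #|` V| <= 12 * m.+4)%N &
    (((m.+1)%:R ^+ 2 / 2)%:E <= expected_steps A V E s t)%E].

(** The check on integers settles the combinatorics. Covering of the plane and boundedness of the
    hull concern all real points and remain hypotheses; [ps] lists pairs known to drift. *)
Lemma figure_slow es (ps : seq (ipt * ipt)) hull aux cells core c t (B : R) A m :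
    figure_check es hull aux cells core c t -> (size es <= 12)%N ->
    (forall p, outer (map emb2 hull) p \/ exists2 d, d \in cells &
      all (fun l => 0 <= side (emb2 l) p) d) ->
    (forall p, ~ outer (map emb2 hull) p -> `|p.1| <= B /\ `|p.2| <= B) ->
    all (fun e => (e.1 \in core) && (e.2 \notin core) ==> (e \in ps)) es ->
    (forall e, e \in ps -> drift A (emb t) (emb e.1) (emb e.2) m) ->
  slow_subdivision A (emb t) m.
Proof.
move=> /and5P[/allP es_neq es_meet es_core es_hull].
move=> /and5P[es_cells cells_disj cells_hull /andP[hull_c hull_sorted]].
move=> /andP[/hasP[e0 e0es e0core] /andP[t_core /hasP[e1 e1es /eqP e1t]]].
move=> size_es cover bounded /allP es_ps drifts.
pose rcore : pred pt := [pred p | p \in map emb core].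
have rcoreE p : rcore (emb p) = (p \in core).
  by rewrite /rcore /= mem_map //; exact: emb_inj.
pose path e := path_edge rcore e.
pose len e := if path e then m.+3 else 1%N.
have /choice[par parP] : forall e, exists lam : nat -> R,
    [/\ lam 0 = 0, lam (len e) = 1, (forall i, (i < len e)%N -> lam i < lam i.+1) &
    e \in map emb2 es -> path e -> forall i, (1 < i < m.+2)%N ->
      2^-1 <= rprob A (comb (lam i) e.1 e.2) (emb t)
        [fset comb (lam i.-1) e.1 e.2; comb (lam i.+1) e.1 e.2]%fset
        (comb (lam i.+1) e.1 e.2)].
  move=> e; rewrite /len; case: ifP => pe; last first.
    by exists (fun i => i%:R); split=> // i _; rewrite ltr_nat.
  have [/mapP[e' e'es Ee]|nes] := boolP (e \in map emb2 es).
    have /drifts [lam [l0 l1 lt dr]] : e' \in ps.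
      apply: (implyP (es_ps e' e'es)); move: pe.
      by rewrite Ee /path /path_edge /= !rcoreE.
    by exists lam; split=> // _ _; rewrite Ee.
  (* Pairs that are not edges of the figure are cut evenly, so that [par] is increasing from 0 to 1
     for every pair. *)
  exists (fun i => i%:R / m.+3%:R); split=> //.
  - by rewrite mul0r.
  - by rewrite divff // pnatr_eq0.
  - by move=> i _; rewrite ltr_pM2r ?invr_gt0 ?ltr0n // ltr_nat.
have par0 e : par e 0 = 0 by case: (parP e).
have par1 e : par e (len e) = 1 by case: (parP e).
have par_lt e i : (i < len e)%N -> par e i < par e i.+1.
  by case: (parP e) => _ _ + _; exact.
have len_gt0 e : (0 < len e)%N by rewrite /len; case: ifP.
have res_neq e : e \in map emb2 es -> e.1 != e.2.
  by move=> /mapP[e' /es_neq ne ->]; apply: contra ne => /eqP/emb_inj ->.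
have res_meet : meet_at_endpoints (map emb2 es).
  move=> _ _ p /mapP[e ees ->] /mapP[f fes ->] ne.
  have /orP[/eqP ef|cert] := allP (allP es_meet e ees) f fes.
    by rewrite ef eqxx in ne.
  exact: meet_certificateP cert.
have res_core e : e \in map emb2 es -> rcore e.2 -> rcore e.1.
  by move=> /mapP[e' e'es ->]; rewrite !rcoreE; exact/implyP/(allP es_core).
pose V := subdiv_vertices (map emb2 es) len par.
pose E := subdiv_edges (map emb2 es) len par.
have rtes : exists2 f, f \in map emb2 es & emb t = f.1.
  by exists (emb2 e1); [exact: map_f|rewrite /= e1t].
have tV : emb t \in V.
  have [f fes ->] := rtes; apply/subdiv_verticesP; exists f, 0%N.
  by rewrite (node0 par0).
have e0path : path (emb2 e0) by rewrite /path /path_edge /= !rcoreE.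
have sV : emb e0.2 \in V.
  apply/subdiv_verticesP; exists (emb2 e0), (len (emb2 e0)).
  by rewrite map_f // (node_len par1).
exists V, E, (emb e0.2); split=> //.
- have cover' p : (~` drawing V E) p <-> outer (map emb2 hull) p \/
      exists2 d, d \in map (map emb2) cells & inner d p.
    have drawE := subdiv_drawing (map emb2 es) len_gt0 par0 par1 par_lt p.
    split=> [nD|HC /drawE.1 [_ /mapP[e ees ->] /seg_comb[x x01 pE]]].
      have [|[d dC dp]] := cover p; first by left.
      have /andP[_ d_drawn] := allP cells_hull d dC.
      have [|[e ees pe]] := closed_cell d_drawn dp.
        by right; exists (map emb2 d) => //; exact: map_f.
      by case: nD; apply/drawE.2; exists (emb2 e) => //; exact: map_f.
    case: HC => [/hasP[_ /mapP[l lH ->]]|[_ /mapP[d dC ->]]].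
      have /andP[l1 l2] := allP (allP es_hull e ees) l lH.
      rewrite pE side_comb !side_emb.
      have {}l1 : 0 <= (side l e.1)%:~R :> R by rewrite ler0z.
      have {}l2 : 0 <= (side l e.2)%:~R :> R by rewrite ler0z.
      by nra.
    (* Each edge avoids the open cell by staying on the wrong side of one of its lines. *)
    have /hasP[l ld /andP[l1 l2]] := allP (allP es_cells e ees) d dC.
    move=> /allP /(_ _ (map_f _ ld)); rewrite pE side_comb !side_emb.
    have {}l1 : (side l e.1)%:~R <= 0 :> R by rewrite lerz0.
    have {}l2 : (side l e.2)%:~R <= 0 :> R by rewrite lerz0.
    by nra.
  have inner_hull : inner (map emb2 hull) (emb c).
    by apply/allP => _ /mapP[l lH ->]; rewrite side_emb ltr0z; exact: (allP hull_c).
  have inner_outer p : inner (map emb2 hull) p -> ~ outer (map emb2 hull) p.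
    by move=> /allP ip /hasP[l /ip]; lra.
  apply: (convex_subdivision_cells cover' _ _ _ bounded).
  + move=> _ _ p /mapP[d dC ->] /mapP[d' d'C ->] dp d'p.
    (* Two distinct cells lie on opposite sides of a common line. *)
    have /orP[/eqP -> //|/hasP[l ld ld']] := allP (allP cells_disj d dC) d' d'C.
    have H1 := allP dp _ (map_f emb2 ld); have H2 := allP d'p _ (map_f emb2 ld').
    by exfalso; move: H1 H2; rewrite /side /=; lra.
  + move=> _ p /mapP[d dC ->] dp; apply: inner_outer; apply/allP => _ /mapP[l lH ->].
    have /andP[/allP dH _] := allP cells_hull d dC.
    by apply: (allP dp); apply: map_f; exact: dH.
  + apply: connected_outer inner_hull; rewrite sorted_map.
    by apply: sub_sorted hull_sorted => l l' /eqP /= ->.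
  + exact: subdiv_plane.
  + have [p [r [r0 Hr]]] := open_has_interior (@open_inner _ (map emb2 hull)) inner_hull.
    by exists p, r; split=> // q q1 q2; apply: inner_outer; exact: Hr.
- apply/andP; split.
    have := card_subdiv_vertices_ge res_neq par_lt (map_f emb2 e0es).
    by rewrite /len e0path; apply: leq_trans; exact: (leq_addl 3 m).
  apply: leq_trans (card_subdiv_vertices_le _ _ (m := m.+3) _) _.
    by move=> e; rewrite /len; case: ifP.
  by rewrite size_map leq_mul2r size_es orbT.
- apply: (subdiv_expected_steps res_neq res_meet len_gt0 par0 par1 par_lt
    (core := rcore) (m := m) res_core _ _ (e := emb2 e0)) => //.
  + by move=> e i ees pe im; case: (parP e) => _ _ _; apply.
  + exact: map_f.
  + by rewrite rcoreE.
Qed.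

(** * Cycles and pinwheels around the target *)

Variables (A : routing_alg R) (m : nat).
Implicit Types (p : pt) (hull : seq (ipt * ipt)).

(** The edge from [q1] to [q2] is cut off from [t] by two paths that both drift away from the core.
    The only bounded face is the interior of [hull]. *)
Lemma cycle_slow (p1 q1 q2 p2 c : ipt) hull aux (B : R) :
    let t : ipt := (0, 0) in
    let es := [:: (t, p1); (p1, q1); (q1, q2); (p2, q2); (t, p2)] in
    figure_check es hull aux [:: hull] [:: t; p1; p2] c t ->
    all (fun e => (e.1 \in [:: t; p1; p2]) && (e.2 \notin [:: t; p1; p2]) ==>
      (e \in [:: (p1, q1); (p2, q2)])) es ->
    (forall p, ~ outer (map emb2 hull) p -> `|p.1| <= B /\ `|p.2| <= B) ->
    drift A (emb t) (emb p1) (emb q1) m ->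
    drift A (emb t) (emb p2) (emb q2) m ->
  slow_subdivision A (emb t) m.
Proof.
move=> t es check paths bounded d1 d2.
apply: (figure_slow check _ _ bounded paths) => // [p|e].
  have [|/hasPn H] := boolP (has (fun l => side l p < 0) (map emb2 hull)).
    by left.
  right; exists hull; rewrite ?mem_head //; apply/allP => l lH.
  by rewrite leNgt; apply: H; exact: map_f.
by rewrite !inE => /orP[]/eqP ->.
Qed.

(* [F1], [F2] and [F3] are the sides of the triangle [X Y Z], each prolonged to
   an outer end. *)
Lemma pinwheel_slow (X X' Y Y' Z Z' c : ipt) (F1 F2 F3 : ipt * ipt) hull (B : R) :
    let t : ipt := (0, 0) in
    let es := [:: (t, X); (t, Y); (t, Z); (X, Y); (Y, Z); (Z, X);
      (X, X'); (Y, Y'); (Z, Z'); (X', Y'); (Y', Z'); (Z', X')] in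
    let cells := [seq hull ++ d | d <- [::
      [:: F1; F2; F3; (t, X); (Y, t)]; [:: F1; F2; F3; (t, Y); (Z, t)];
      [:: F1; F2; F3; (t, Z); (X, t)];
      [:: F1; (F2.2, F2.1)]; [:: F2; (F3.2, F3.1)]; [:: F3; (F1.2, F1.1)]]] in
    figure_check es hull [:: (t, X); (t, Y); (t, Z)] cells [:: t; X; Y; Z] c t ->
    all (fun e => (e.1 \in [:: t; X; Y; Z]) && (e.2 \notin [:: t; X; Y; Z]) ==>
      (e \in [:: (X, X'); (Y, Y'); (Z, Z')])) es ->
    (forall p, ~ outer (map emb2 hull) p -> `|p.1| <= B /\ `|p.2| <= B) ->
    (forall p, ~ [/\ side (emb2 F1) p < 0, side (emb2 F2) p < 0 &
      side (emb2 F3) p < 0]) ->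
    (forall p, ~ [/\ 0 < side (emb2 (t, X)) p, 0 < side (emb2 (t, Y)) p &
      0 < side (emb2 (t, Z)) p]) ->
    (forall p, ~ [/\ side (emb2 (t, X)) p < 0, side (emb2 (t, Y)) p < 0 &
      side (emb2 (t, Z)) p < 0]) ->
    drift A (emb t) (emb X) (emb X') m ->
    drift A (emb t) (emb Y) (emb Y') m ->
    drift A (emb t) (emb Z) (emb Z') m ->
  slow_subdivision A (emb t) m.
Proof.
move=> t es cells check paths bounded F_neg S_pos S_neg dX dY dZ.
apply: (figure_slow check _ _ bounded paths) => // [p|e]; last first.
  by rewrite !inE => /or3P[]/eqP ->.
have [|/hasPn H] := boolP (has (fun l => side l p < 0) (map emb2 hull)).
  by left.
have {}H : all (fun l => 0 <= side (emb2 l) p) hull.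
  by apply/allP => l lH; rewrite leNgt; apply: H; exact: map_f.
right; pose inside d := all (fun l => 0 <= side (emb2 l) p) d.
(* The signs with respect to [F1], [F2], [F3] are not all negative. If they differ, a cyclic change
   from nonnegative to negative selects a cell between two exits; otherwise [p] is in the triangle,
   and a change among the rays from [t] selects a sector. *)
suff /hasP[d dC ins] : has inside [::
      [:: F1; F2; F3; (t, X); (Y, t)]; [:: F1; F2; F3; (t, Y); (Z, t)];
      [:: F1; F2; F3; (t, Z); (X, t)];
      [:: F1; (F2.2, F2.1)]; [:: F2; (F3.2, F3.1)]; [:: F3; (F1.2, F1.1)]].
  by exists (hull ++ d); [exact: map_f|rewrite all_cat H].
have rev l : side (emb2 (l.2, l.1)) p = - side (emb2 l) p.
  exact: (side_rev (emb2 l)).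
rewrite /inside /= !rev (rev (t, Y)) (rev (t, Z)) (rev (t, X)) !oppr_ge0 !andbT.
have := F_neg p; have := S_pos p; have := S_neg p.
case: (lerP 0 (side (emb2 F1) p)) => [h1|/[dup] /ltW -> h1];
case: (lerP 0 (side (emb2 F2) p)) => [h2|/[dup] /ltW -> h2];
case: (lerP 0 (side (emb2 F3) p)) => [h3|/[dup] /ltW -> h3];
  rewrite ?orbT //=; try by move=> _ _ [].
move=> Sneg Spos _; move: Sneg Spos.
case: (ltrgtP (side (emb2 (t, X)) p) 0) => sX;
case: (ltrgtP (side (emb2 (t, Y)) p) 0) => sY;
case: (ltrgtP (side (emb2 (t, Z)) p) 0) => sZ; rewrite ?orbT //=;
  by [move=> []|move=> _ []].
Qed.

Ltac bound_hull :=
  move=> [x y] /negP; rewrite /outer /side /= !negb_or -!leNgt !ler_norml;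
  repeat (case/andP => ?); move=> _; split; apply/andP; split; lra.

Lemma slow_subdivision_exists : slow_subdivision A (emb (0, 0)) m.
Proof.
(* The exits (a, a1), (b, b1), (c, c1) turn counterclockwise around the origin
   and prolong ca, ab, bc; the exits (a, a2), (b, b2), (c, c2) turn clockwise. *)
pose a : ipt := (2, 0); pose b : ipt := (0, 2); pose c : ipt := (-2, -2).
pose a1 : ipt := (10, 4); pose b1 : ipt := (-4, 6); pose c1 : ipt := (-6, -10).
pose a2 : ipt := (6, -4); pose b2 : ipt := (4, 10); pose c2 : ipt := (-10, -6).
pose t : ipt := (0, 0).
have dichotomy x y : x != y -> drift A (emb t) (emb x) (emb y) m \/
    drift A (emb t) (emb y) (emb x) m.
  by move=> xy; apply: drift_dichotomy; apply: contra xy => /eqP/emb_inj ->.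
(* [pent] uses exits that drift outwards at consecutive corners, and [tri] exits on one line that
   drift inwards. The point [d] is interior to the polygon. All coordinates are at most 10 in
   absolute value, whence the bound 20. *)
have pent (p1 q1 q2 p2 d : ipt) : (p1, q1, q2, p2, d) \in
    [:: (a, a1, b2, b, (1, 1)); (b, b1, c2, c, (-1, 0)); (c, c1, a2, a, (0, -1))] ->
  drift A (emb t) (emb p1) (emb q1) m ->
  drift A (emb t) (emb p2) (emb q2) m -> slow_subdivision A (emb t) m.
  move=> ps; apply: (@cycle_slow p1 q1 q2 p2 d
    [:: (t, p1); (p1, q1); (q1, q2); (q2, p2); (p2, t)] [::] 20);
    move: ps; rewrite !inE => /or3P[] /eqP[? ? ? ? ?];
    subst p1 q1 q2 p2 d;
    by [vm_compute|bound_hull].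
have tri (p1 q1 q2 p2 d : ipt) : (p1, q1, q2, p2, d) \in
    [:: (a2, a, b, b1, (1, 0)); (b2, b, c, c1, (0, 1)); (c2, c, a, a1, (-1, -1))] ->
  drift A (emb t) (emb p1) (emb q1) m ->
  drift A (emb t) (emb p2) (emb q2) m -> slow_subdivision A (emb t) m.
  (* The paths and the edge joining them are collinear here, so the lines from [t] through [q1] and
     [q2] serve to separate them. *)
  move=> ps; apply: (@cycle_slow p1 q1 q2 p2 d
    [:: (t, p1); (p1, p2); (p2, t)] [:: (t, q1); (t, q2)] 20);
    move: ps; rewrite !inE => /or3P[] /eqP[? ? ? ? ?];
    subst p1 q1 q2 p2 d;
    by [vm_compute|bound_hull].
have wheel1 : drift A (emb t) (emb a) (emb a1) m ->
    drift A (emb t) (emb b) (emb b1) m ->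
    drift A (emb t) (emb c) (emb c1) m -> slow_subdivision A (emb t) m.
  apply: (@pinwheel_slow a a1 b b1 c c1 t (c, a1) (a, b1) (b, c1)
    [:: (a1, b1); (b1, c1); (c1, a1)] 20);
    by [vm_compute|bound_hull|move=> [x y]; rewrite /side /= => -[]; lra].
have wheel2 : drift A (emb t) (emb a) (emb a2) m ->
    drift A (emb t) (emb b) (emb b2) m ->
    drift A (emb t) (emb c) (emb c2) m -> slow_subdivision A (emb t) m.
  apply: (@pinwheel_slow a a2 b b2 c c2 t (b2, c) (a2, b) (c2, a)
    [:: (a2, b2); (b2, c2); (c2, a2)] 20);
    by [vm_compute|bound_hull|move=> [x y]; rewrite /side /= => -[]; lra].
have pentA := pent a a1 b2 b (1, 1) isT.
have pentB := pent b b1 c2 c (-1, 0) isT.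
have pentC := pent c c1 a2 a (0, -1) isT.
have triA := tri a2 a b b1 (1, 0) isT.
have triB := tri b2 b c c1 (0, 1) isT.
have triC := tri c2 c a a1 (-1, -1) isT.
(* Unless one of the six cycles applies, outward drift towards a1 forces inward
   drift from b2, hence outward drift towards c1, and so on around through a2,
   b1 and c2: the exits of one of the two pinwheels all drift outwards. *)
by have [A1|A1] := dichotomy a a1 isT; have [A2|A2] := dichotomy a a2 isT;
  have [B1|B1] := dichotomy b b1 isT; have [B2|B2] := dichotomy b b2 isT;
  have [C1|C1] := dichotomy c c1 isT; have [C2|C2] := dichotomy c c2 isT;
  first [exact: pentA A1 B2|exact: pentB B1 C2|exact: pentC C1 A2|
         exact: triA A2 B1|exact: triB B2 C1|exact: triC C2 A1|
         exact: wheel1 A1 B1 C1|exact: wheel2 A2 B2 C2].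
Qed.

End Figure.

Theorem theorem2 (R : realType) :
  exists c1 c2 c3 : R, [/\ 0 < c1, 0 < c2 & 0 < c3] /\
  forall (k : nat), (0 < k)%N -> forall A : routing_alg R,
  exists (V : {fset (R * R)%type}) (E : {fset (R * R)%type * (R * R)%type}) (s t : (R * R)%type),
    [/\ convex_subdivision V E, s \in V, t \in V,
        c1 * k%:R <= (#|` V|%fset)%:R <= c2 * k%:R &
        ((c3 * (k%:R) ^+ 2)%:E <= expected_steps A V E s t)%E].
Proof.
(* With [m = k], the bound [12 * k.+4] is at most [60 * k] because [k] is positive. *)
exists 1, 60, 2^-1; split=> [|k k0 A]; first by rewrite !ltr0n invr_gt0 ltr0n.
have [V [E [s [cs sV tV /andP[Vge Vle] steps]]]] := slow_subdivision_exists A k.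
exists V, E, s, (emb R (0, 0)); split=> //.
  rewrite mul1r ler_nat Vge -natrM ler_nat (leq_trans Vle) //; lia.
apply: le_trans steps; rewrite lee_fin mulrC ler_pM2r ?invr_gt0 ?ltr0n //.
by rewrite ler_sqr ?nnegrE ?ler0n // ler_nat.
Qed.
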